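(* Let $D_1,D_2\ge1$, $D=D_1D_2$, let $\varrho$ be a density operator on $\mathbb{C}^{D_1}\otimes\mathbb{C}^{D_2}$, and let $\varrho_1=\mathrm{Tr}_2\,\varrho$ and $\varrho_2=\mathrm{Tr}_1\,\varrho$ be its reduced density operators. Then $$\frac{\Sigma(\varrho)^2}{D}\ \le\ \Sigma(\varrho_1)\Sigma(\varrho_2)\ \le\ \frac{[D+\Sigma(\varrho)]^2}{4D},$$ and, equivalently, $$\max\left\{0,\ 2\sqrt{D\,\Sigma(\varrho_1)\Sigma(\varrho_2)}-D\right\}\ \le\ \Sigma(\varrho)\ \le\ \sqrt{D\,\Sigma(\varrho_1)\Sigma(\varrho_2)}.$$
   Context: For a density operator $\omega$ on $\mathbb{C}^{d}$ the grand sum is $\Sigma(\omega)=\sum_{i,j=1}^{d}\omega_{ij}=d\,\langle f_1^{(d)}|\omega|f_1^{(d)}\rangle$, where matrix entries are taken in the standard basis and $|f_1^{(d)}\rangle=\frac1{\sqrt d}\sum_{j=1}^d|j\rangle$. For the bipartite space $\mathbb{C}^{D_1}\otimes\mathbb{C}^{D_2}$ the product standard basis is used, so that $|f_1^{(D)}\rangle=|f_1^{(D_1)}\rangle\otimes|f_1^{(D_2)}\rangle$. *)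

(* Defs.v *)
From HB Require Import structures.
From mathcomp Require Import all_boot all_order all_algebra.
From mathcomp Require Export complex.
From mathcomp Require Export mxtens.
From mathcomp Require Export reals.

Set Implicit Arguments.
Unset Strict Implicit.
Unset Printing Implicit Defensive.

Import Order.TTheory GRing.Theory Num.Theory.
Local Open Scope ring_scope.
Local Open Scope sesquilinear_scope.

(* The order on a numClosedFieldType is the partial one: [x <= y] says that
   [y - x] is real and nonnegative; in particular [0 <= x] forces x to be
   real. *)

Definition is_density (C : numClosedFieldType) (d : nat) (w : 'M[C]_d) : Prop :=
  [/\ w \is hermsymmx,
      forall v : 'cV[C]_d, 0 <= (v^t* *m w *m v) 0 0
    & \tr w = 1].

Definition grandsum (C : numClosedFieldType) (d : nat) (w : 'M[C]_d) : C :=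
  \sum_(i < d) \sum_(j < d) w i j.

(* The product basis vector |i>|j> of C^m (x) C^n has index
   [mxtens_index (i, j)] in 'I_(m * n); this is the indexing used by the
   Kronecker product [tensmx]. *)

(* trace over the second factor *)
Definition ptrace2 (C : numClosedFieldType) (m n : nat) (w : 'M[C]_(m * n)) :
    'M[C]_m :=
  \matrix_(i, k) \sum_(j < n) w (mxtens_index (i, j)) (mxtens_index (k, j)).

(* trace over the first factor *)
Definition ptrace1 (C : numClosedFieldType) (m n : nat) (w : 'M[C]_(m * n)) :
    'M[C]_n :=
  \matrix_(j, l) \sum_(i < m) w (mxtens_index (i, j)) (mxtens_index (i, l)).

(* |f_1^(d)> *)
Definition fvec1 (C : numClosedFieldType) (d : nat) : 'cV[C]_d :=
  const_mx (sqrtC d%:R)^-1.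

Section Facts.
Variable C : numClosedFieldType.

Lemma grandsumE d (w : 'M[C]_d) :
  grandsum w = d%:R * ((fvec1 C d)^t* *m w *m fvec1 C d) 0 0.
Proof.
case: d w => [|d] w; first by rewrite mul0r /grandsum big_ord0.
have dn0 : d.+1%:R != 0 :> C by rewrite pnatr_eq0.
have cs : ((sqrtC d.+1%:R : C)^-1)^* = (sqrtC d.+1%:R)^-1.
  by rewrite conj_Creal // rpredV ger0_real // sqrtC_ge0 ler0n.
rewrite mxE /grandsum exchange_big mulr_sumr; apply: eq_bigr => j _.
rewrite !mxE mulr_suml mulr_sumr; apply: eq_bigr => i _.
rewrite !mxE cs mulrAC -invfM -expr2 sqrtCK mulrA.
by rewrite divff ?mul1r.
Qed.

Lemma fvec1_tens m n (i : 'I_(m * n)) :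
  fvec1 C (m * n) i 0 =
  fvec1 C m (mxtens_unindex i).1 0 * fvec1 C n (mxtens_unindex i).2 0.
Proof. by rewrite !mxE natrM rootCMl ?ler0n// invfM. Qed.

Lemma quadE d (w : 'M[C]_d) (v : 'cV[C]_d) :
  (v^t* *m w *m v) 0 0 = \sum_i \sum_j (v i 0)^* * w i j * v j 0.
Proof.
rewrite mxE exchange_big; apply: eq_bigr => j _.
by rewrite mxE mulr_suml; apply: eq_bigr => i _; rewrite !mxE.
Qed.

Lemma hermE d (w : 'M[C]_d) :
  w \is hermsymmx <-> (forall i j, w i j = (w j i)^*).
Proof.
split=> [/is_hermitianmxP E i j|E].
  by rewrite {1}E expr0 scale1r !mxE.
by apply/is_hermitianmxP/matrixP => i j; rewrite expr0 scale1r !mxE -E.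
Qed.

Lemma big_mxtens m n (F : 'I_(m * n) -> C) :
  \sum_k F k = \sum_(i < m) \sum_(j < n) F (mxtens_index (i, j)).
Proof.
rewrite pair_big /= (reindex (@mxtens_index m n)) /=.
  by apply: eq_bigr => -[].
by exists (@mxtens_unindex m n) => i _; rewrite (mxtens_indexK, mxtens_unindexK).
Qed.

Lemma grandsum_ge0 d (w : 'M[C]_d) : is_density w -> 0 <= grandsum w.
Proof. by move=> [_ w_ge0 _]; rewrite grandsumE mulr_ge0 ?ler0n. Qed.

Lemma density_ptrace2 m n (w : 'M[C]_(m * n)) :
  is_density w -> is_density (ptrace2 w).
Proof.
move=> [/hermE wH w_ge0 w1]; split.
- apply/hermE => i k; rewrite !mxE rmorph_sum.
  by apply: eq_bigr => j _; apply: wH.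
- move=> v; rewrite quadE.
  suff -> : \sum_i \sum_k (v i 0)^* * ptrace2 w i k * v k 0 =
     \sum_(j < n) ((v *t delta_mx j (0 : 'I_1))^t* *m w
                   *m (v *t delta_mx j (0 : 'I_1))) 0 0.
    by apply: sumr_ge0 => j _; apply: w_ge0.
  under [RHS]eq_bigr => j _ do rewrite quadE big_mxtens.
  rewrite [RHS]exchange_big; apply: eq_bigr => i _.
  under [RHS]eq_bigr => j _.
    rewrite (bigD1 j) //= [X in _ + X]big1 ?addr0; last first.
      move=> l /negPf lj; apply: big1 => p _.
      by rewrite !mxE !mxtens_indexK /= lj mulr0 conjC0 !mul0r.
    rewrite big_mxtens; over.
  rewrite [RHS]exchange_big; apply: eq_bigr => k _.
  rewrite !mxE mulr_sumr mulr_suml; apply: eq_bigr => j _.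
  rewrite (bigD1 j) //= [X in _ + X]big1 ?addr0.
    by rewrite !mxE !mxtens_indexK /= !eqxx !ord1 !mulr1.
  by move=> l /negPf lj; rewrite !mxE !mxtens_indexK /= lj !mulr0.
- by rewrite -w1 /mxtrace big_mxtens; apply: eq_bigr => i _; rewrite mxE.
Qed.

Lemma density_ptrace1 m n (w : 'M[C]_(m * n)) :
  is_density w -> is_density (ptrace1 w).
Proof.
move=> [/hermE wH w_ge0 w1]; split.
- apply/hermE => j l; rewrite !mxE rmorph_sum.
  by apply: eq_bigr => i _; apply: wH.
- move=> v; rewrite quadE.
  suff -> : \sum_j \sum_l (v j 0)^* * ptrace1 w j l * v l 0 =
     \sum_(i < m) ((delta_mx i (0 : 'I_1) *t v)^t* *m w
                   *m (delta_mx i (0 : 'I_1) *t v)) 0 0.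
    by apply: sumr_ge0 => i _; apply: w_ge0.
  under [RHS]eq_bigr => i _.
    rewrite quadE big_mxtens (bigD1 i) //= [X in _ + X]big1 ?addr0; last first.
      move=> k /negPf ki; apply: big1 => j _; apply: big1 => p _.
      by rewrite !mxE !mxtens_indexK /= ki mul0r conjC0 !mul0r.
    over.
  rewrite [RHS]exchange_big; apply: eq_bigr => j _.
  under [RHS]eq_bigr => i _.
    rewrite big_mxtens (bigD1 i) //= [X in _ + X]big1 ?addr0; last first.
      move=> k /negPf ki; apply: big1 => l _.
      by rewrite !mxE !mxtens_indexK /= ki mul0r !mulr0.
    over.
  rewrite [RHS]exchange_big; apply: eq_bigr => l _.
  rewrite !mxE mulr_sumr mulr_suml; apply: eq_bigr => i _.
  by rewrite !mxE !mxtens_indexK /= !eqxx !ord1 !mul1r.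
- rewrite -w1 /mxtrace big_mxtens exchange_big.
  by apply: eq_bigr => j _; rewrite mxE.
Qed.

End Facts.

(* Main.v *)
(** With [P1 = |f1><f1| (x) 1] and [P2 = 1 (x) |f1><f1|], the expectations in
    [rho] of [P1], [P2] and [P1 P2] are [a = Sigma(rho1) / D1],
    [b = Sigma(rho2) / D2] and [s = Sigma(rho) / D]. The products
    [P1 (1 - P2)], [(1 - P1) P2] and [(1 - P1) (1 - P2)] are orthogonal
    projections, hence have nonnegative expectations, which gives [s <= a],
    [s <= b] and [a + b <= 1 + s]. Therefore [s ^+ 2 <= a * b], and by AM-GM
    [4 * (a * b) <= (1 + s) ^+ 2]. *)
Require Import Defs.
From mathcomp Require Import all_boot all_order all_algebra.
From mathcomp Require Import ring.
Import Order.TTheory GRing.Theory Num.Theory.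
Local Open Scope ring_scope.
Local Open Scope complex_scope.
Local Open Scope sesquilinear_scope.

Section OrthogonalProjections.
Context {C : numClosedFieldType}.

Definition is_orthoproj {d : nat} (A : 'M[C]_d) : Prop :=
  A^t* = A /\ A *m A = A.

Lemma is_orthoproj_compl {d} (A : 'M[C]_d) :
  is_orthoproj A -> is_orthoproj (1%:M - A).
Proof.
move=> [AH AA]; split.
  by rewrite linearB map_mxB /= AH tr_scalar_mx map_scalar_mx rmorph1.
by rewrite mulmxBl mul1mx mulmxBr mulmx1 AA subrr subr0.
Qed.

Lemma is_orthoproj_tens {m n} (A : 'M[C]_m) (B : 'M[C]_n) :
  is_orthoproj A -> is_orthoproj B -> is_orthoproj (A *t B).
Proof.
move=> [AH AA] [BH BB]; split; first by rewrite trmx_tens map_mxT AH BH.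
by rewrite tensmx_mul AA BB.
Qed.

(** As [A] is idempotent and self-adjoint, cyclicity of the trace gives
    [\tr (w *m A) = \tr (A^t* *m w *m A)]. The diagonal entries of that matrix are values of the
    quadratic form of [w] at the columns of [A]. *)
Lemma expect_orthoproj_ge0 {d} (w A : 'M[C]_d) :
  is_density w -> is_orthoproj A -> 0 <= \tr (w *m A).
Proof.
move=> [_ w_ge0 _] [AH AA].
have -> : \tr (w *m A) = \tr (A^t* *m w *m A).
  by rewrite AH [RHS]mxtrace_mulC mulmxA AA mxtrace_mulC.
apply: sumr_ge0 => i _.
have -> : (A^t* *m w *m A) i i = ((col i A)^t* *m w *m col i A) 0 0.
  rewrite !mxE; apply: eq_bigr => k _; rewrite !mxE; congr (_ * _).
  by apply: eq_bigr => l _; rewrite !mxE.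
exact: w_ge0.
Qed.

Lemma tensmxDl {m n p q} (A B : 'M[C]_(m, n)) (M : 'M[C]_(p, q)) :
  (A + B) *t M = A *t M + B *t M.
Proof. by apply/matrixP => i j; rewrite !mxE mulrDl. Qed.

Lemma tensmxDr {m n p q} (M : 'M[C]_(m, n)) (A B : 'M[C]_(p, q)) :
  M *t (A + B) = M *t A + M *t B.
Proof. by apply/matrixP => i j; rewrite !mxE mulrDr. Qed.

Lemma tens1mx1 {m n} : (1%:M : 'M[C]_m) *t (1%:M : 'M[C]_n) = 1%:M.
Proof.
apply/matrixP => k l; rewrite -(mxtens_unindexK k) -(mxtens_unindexK l).
case: (mxtens_unindex k) (mxtens_unindex l) => [i j] [i' j'].
rewrite tensmxE !mxE (can_eq (@mxtens_indexK _ _)) xpair_eqE.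
by rewrite mulr_natr -mulrnA mulnb andbC.
Qed.

(** Partial trace is dual to tensoring with the identity. This moves expectations in a reduced state
    to the full state, where they can be compared. *)
Lemma mxtrace_ptrace2 {m n} (w : 'M[C]_(m * n)) (A : 'M[C]_m) :
  \tr (ptrace2 w *m A) = \tr (w *m (A *t 1%:M)).
Proof.
rewrite /mxtrace big_mxtens; apply: eq_bigr => i _.
rewrite mxE.
under [RHS]eq_bigr do rewrite mxE big_mxtens.
rewrite [RHS]exchange_big; apply: eq_bigr => k _.
rewrite mxE mulr_suml; apply: eq_bigr => j _.
(* The identity factor kills every term with [l != j]. *)
rewrite (bigD1 j) //= big1 => [|l /negPf lj]; rewrite tensmxE !mxE.
  by rewrite eqxx mulr1 addr0.
by rewrite lj !mulr0.
Qed.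

Lemma mxtrace_ptrace1 {m n} (w : 'M[C]_(m * n)) (A : 'M[C]_n) :
  \tr (ptrace1 w *m A) = \tr (w *m (1%:M *t A)).
Proof.
rewrite /mxtrace big_mxtens exchange_big; apply: eq_bigr => j _.
rewrite mxE.
under [RHS]eq_bigr do rewrite mxE big_mxtens exchange_big.
rewrite [RHS]exchange_big; apply: eq_bigr => l _.
rewrite mxE mulr_suml; apply: eq_bigr => i _.
rewrite (bigD1 i) //= big1 => [|k /negPf ki]; rewrite tensmxE !mxE.
  by rewrite eqxx mul1r addr0.
by rewrite ki mul0r mulr0.
Qed.

(* [|f_1^(d)><f_1^(d)|] *)
Definition fproj (d : nat) : 'M[C]_d := const_mx d%:R^-1.

Lemma is_orthoproj_fproj d : is_orthoproj (fproj d).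
Proof.
split; first by rewrite trmx_const map_const_mx fmorphV rmorph_nat.
apply/matrixP => i j; rewrite !mxE.
under eq_bigr do rewrite !mxE.
rewrite sumr_const card_ord -[LHS]mulr_natr -mulrA mulVf ?mulr1 //.
(* The index [i] rules out [d = 0], so [d%:R] is invertible. *)
by rewrite pnatr_eq0; case: d i {j} => // -[].
Qed.

Lemma tens_fproj m n : fproj m *t fproj n = fproj (m * n).
Proof. by apply/matrixP => i j; rewrite !mxE natrM invfM. Qed.

Lemma grandsum_fproj {d} (w : 'M[C]_d) :
  grandsum w = d%:R * \tr (w *m fproj d).
Proof.
rewrite /grandsum mulr_sumr; apply: eq_bigr => i _.
rewrite mxE mulr_sumr; apply: eq_bigr => j _.
rewrite mxE mulrCA divff ?mulr1 //.
by rewrite pnatr_eq0; case: d w i j => // w [].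
Qed.

Lemma expect_tens_bounds {m n} (w : 'M[C]_(m * n)) (P : 'M[C]_m) (Q : 'M[C]_n) :
  is_density w -> is_orthoproj P -> is_orthoproj Q ->
  [/\ \tr (w *m (P *t Q)) <= \tr (w *m (P *t 1%:M)),
      \tr (w *m (P *t Q)) <= \tr (w *m (1%:M *t Q))
    & \tr (w *m (P *t 1%:M)) + \tr (w *m (1%:M *t Q))
        <= 1 + \tr (w *m (P *t Q))].
Proof.
move=> hw hP hQ; have [hP' hQ'] := (is_orthoproj_compl _ hP, is_orthoproj_compl _ hQ).
have [_ _ w1] := hw.
have eP : P *t 1%:M = P *t Q + P *t (1%:M - Q) by rewrite -tensmxDr addrC subrK.
have eQ : 1%:M *t Q = P *t Q + (1%:M - P) *t Q by rewrite -tensmxDl addrC subrK.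
have e1 : 1%:M = P *t 1%:M + ((1%:M - P) *t Q + (1%:M - P) *t (1%:M - Q)).
  by rewrite -tensmxDr [Q + _]addrC subrK -tensmxDl addrC subrK tens1mx1.
have gP := expect_orthoproj_ge0 _ _ hw (is_orthoproj_tens _ _ hP hQ').
have gQ := expect_orthoproj_ge0 _ _ hw (is_orthoproj_tens _ _ hP' hQ).
have g1 := expect_orthoproj_ge0 _ _ hw (is_orthoproj_tens _ _ hP' hQ').
split; first by rewrite eP mulmxDr mxtraceD lerDl.
  by rewrite eQ mulmxDr mxtraceD lerDl.
have -> : 1 + \tr (w *m (P *t Q)) = \tr (w *m 1%:M) + \tr (w *m (P *t Q)).
  by rewrite mulmx1 w1.
rewrite e1 eQ !(mulmxDr, mxtraceD).
(* After expansion, the two sides differ exactly by the expectation of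
   [(1%:M - P) *t (1%:M - Q)]. *)
rewrite -subr_ge0; move: g1; congr (0 <= _); ring.
Qed.

End OrthogonalProjections.

Lemma mulr4_le_sqrD {C : numDomainType} (a b : C) :
  0 <= a -> 0 <= b -> 4 * (a * b) <= (a + b) ^+ 2.
Proof.
move=> a_ge0 b_ge0; rewrite -subr_ge0.
have -> : (a + b) ^+ 2 - 4 * (a * b) = (a - b) ^+ 2 by ring.
(* The order is partial, so a square is known to be nonnegative only once [a - b] is real; the signs
   of [a] and [b] ensure this. *)
by apply: real_exprn_even_ge0; rewrite // rpredB ?ger0_real.
Qed.

(** This form, free of divisions and roots, yields both versions of the theorem. In terms of the
    normalized expectations, a common factor [(m * n)%:R ^+ 2] splits off each inequality. *)
Lemma grandsum_ptrace_bounds {C : numClosedFieldType} (m n : nat)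
    (w : 'M[C]_(m * n)) : (1 <= m)%N -> (1 <= n)%N -> is_density w ->
  let p := (m * n)%:R * (grandsum (ptrace2 w) * grandsum (ptrace1 w)) in
  grandsum w ^+ 2 <= p /\ 4 * p <= ((m * n)%:R + grandsum w) ^+ 2.
Proof.
move=> m_gt0 n_gt0 hw /=.
have [] := expect_tens_bounds w _ _ hw
  (is_orthoproj_fproj m) (is_orthoproj_fproj n).
have := expect_orthoproj_ge0 w _ hw (is_orthoproj_fproj (m * n)).
rewrite !grandsum_fproj mxtrace_ptrace2 mxtrace_ptrace1 tens_fproj.
set s := \tr _; set a := \tr _; set b := \tr _ => s0 sa sb abs.
have [a0 b0] := (le_trans s0 sa, le_trans s0 sb).
have -> : (m * n)%:R * (m%:R * a * (n%:R * b)) = (m * n)%:R ^+ 2 * (a * b) :> C.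
  by rewrite natrM; ring.
split.
  by rewrite exprMn ler_wpM2l ?exprn_ge0 ?ler0n // expr2 ler_pM.
have -> : (m * n)%:R + (m * n)%:R * s = (m * n)%:R * (1 + s) by ring.
rewrite exprMn mulrCA ler_wpM2l ?exprn_ge0 ?ler0n //.
apply: le_trans (mulr4_le_sqrD _ _ a0 b0) _.
by rewrite lerXn2r ?nnegrE ?addr_ge0.
Qed.

Theorem mainTheorem6 (R : realType) (D1 D2 : nat) (rho : 'M[R[i]]_(D1 * D2))
    (hD1 : (1 <= D1)%N) (hD2 : (1 <= D2)%N) (hrho : is_density rho) :
  let D : R[i] := (D1 * D2)%:R in
  let rho1 : 'M[R[i]]_D1 := ptrace2 rho in
  let rho2 : 'M[R[i]]_D2 := ptrace1 rho in
  (grandsum rho ^+ 2 / D <= grandsum rho1 * grandsum rho2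
     <= (D + grandsum rho) ^+ 2 / (4 * D)) /\
  (Num.max 0 (2 * sqrtC (D * (grandsum rho1 * grandsum rho2)) - D)
     <= grandsum rho
     <= sqrtC (D * (grandsum rho1 * grandsum rho2))).
Proof.
move=> D rho1 rho2.
have [lo up] := grandsum_ptrace_bounds _ _ _ hD1 hD2 hrho.
rewrite -/D -/rho1 -/rho2 in lo up.
have D_gt0 : 0 < D by rewrite ltr0n muln_gt0 hD1.
have S_ge0 := grandsum_ge0 hrho.
split.
  rewrite ler_pdivrMr // [leRHS]mulrC lo /=.
  by rewrite ler_pdivlMr ?mulr_gt0 // mulrC -mulrA.
set p := D * _ in lo up *.
have p_ge0 : 0 <= p by apply: le_trans lo; rewrite exprn_ge0.
have q_ge0 : 0 <= sqrtC p by rewrite sqrtC_ge0.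
apply/andP; split.
  (* The maximum is unfolded to its defining conditional, since the order on [R[i]] is not total;
     the branch [0] is closed by [S_ge0]. *)
  rewrite /Num.max; case: ifP => // _.
  (* With [D] moved to the right, both sides are nonnegative, and squaring gives [up]. *)
  rewrite lerBlDl -(@ler_pXn2r _ 2) ?nnegrE ?mulr_ge0 ?addr_ge0 ?ler0n ?(ltW D_gt0) //.
  by rewrite exprMn sqrtCK -natrX.
by rewrite -(@ler_pXn2r _ 2) ?nnegrE // sqrtCK.
Qed.
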